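(* Let $\alpha \in [0,1/2)$ and let $F$ be a graph with $\mathrm{ex}(F,m) = O(m^{1+\alpha})$ (as $m \to \infty$). Then $$f_{F,K_4}(n) = O\left( n^{\frac{1}{3-2\alpha}} (\log n)^{\frac{4}{3-2\alpha}} \right)$$ as $n \to \infty$, where the implied constant may depend on $F$ and $\alpha$ but not on $n$.
   Context: All graphs are finite and simple. A graph is $F$-free if it does not contain $F$ as a (not necessarily induced) subgraph. $\mathrm{ex}(F,m)$ denotes the largest number of edges in an $F$-free graph with $m$ vertices. For graphs $F$ and $H$, $f_{F,H}(n)$ denotes the largest integer $m$ such that every $H$-free graph with $n$ vertices contains an $F$-free induced subgraph on $m$ vertices. $K_4$ is the complete graph on $4$ vertices. *)

(* Defs.v *)
From HB Require Import structures.
From mathcomp Require Import all_boot all_order all_algebra.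
From mathcomp Require Import all_classical all_reals all_analysis.
Set Implicit Arguments.
Unset Strict Implicit.
Unset Printing Implicit Defensive.

Record sgraph := SGraph {
  vertex :> finType;
  adj : rel vertex;
  adj_sym : symmetric adj;
  adj_irrefl : irreflexive adj }.

Definition edges (G : sgraph) : {set {set G}} :=
  [set e | [exists x : G, exists y : G, adj x y && (e == [set x; y])]].

Lemma complete_sym k : symmetric (fun x y : 'I_k => x != y).
Proof. by move=> x y; rewrite eq_sym. Qed.

Lemma complete_irrefl k : irreflexive (fun x y : 'I_k => x != y).
Proof. by move=> x; rewrite eqxx. Qed.

Definition complete (k : nat) : sgraph :=
  SGraph (@complete_sym k) (@complete_irrefl k).

Section Induced.
Variables (G : sgraph) (S : {set G}).

Definition induced_adj : rel {x : G | x \in S} :=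
  fun x y => adj (val x) (val y).

Lemma induced_sym : symmetric induced_adj.
Proof. by move=> x y; exact: adj_sym. Qed.

Lemma induced_irrefl : irreflexive induced_adj.
Proof. by move=> x; exact: adj_irrefl. Qed.

Definition induced : sgraph := SGraph induced_sym induced_irrefl.

End Induced.

(* Subgraphs need not be induced: non-edges of F may be sent to edges of G. *)
Definition has_subgraph (F G : sgraph) : Prop :=
  exists2 f : F -> G, injective f & forall x y, adj x y -> adj (f x) (f y).

Definition free (F G : sgraph) : Prop := ~ has_subgraph F G.

(* A graph on m vertices has at most 'C(m, 2) edges, so the range of e does
   not restrict the maximum.  It is 0 if no F-free graph on m vertices exists,
   which can only happen if F has no edges. *)
Definition ex (F : sgraph) (m : nat) : nat :=
  \max_(e < 'C(m, 2).+1 |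
        `[< exists G : sgraph, [/\ #|G| = m, free F G & #|edges G| = e] >]) e.

(* Whenever some H-free graph on n vertices exists (for instance if H has an
   edge), only values m <= n can satisfy the condition, so the range of m does
   not restrict the maximum.  The condition holds for m = 0 unless F is the
   graph without vertices. *)
Definition induced_free_number (F H : sgraph) (n : nat) : nat :=
  \max_(m < n.+1 |
        `[< forall G : sgraph, #|G| = n -> free H G ->
              exists2 S : {set G}, #|S| = m & free F (induced S) >]) m.

(* Main.v *)
Require Import Defs.
From HB Require Import structures.
From mathcomp Require Import all_boot all_order all_algebra.
From mathcomp Require Import finfield.
From mathcomp Require Import ring lra zify.
Import Order.TTheory GRing.Theory Num.Theory.
Set Implicit Arguments.
Unset Strict Implicit.
Unset Printing Implicit Defensive.

(** The proof starts from the graphs of Mattheus and Verstraete. Let q be a power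
    of 2. In the plane over the field of order q^2, the Hermitian curve has about
    q^3 points, and about q^4 secant lines with about q points each. Join two
    secants when they meet on the curve. A complete graph on four secants has three
    concurrent ones, because four secants in general position cannot have all their
    intersections on the curve ([no_onan]). Colour each incidence of a point and a
    secant with one of two colours, and keep only the edges at a point between
    secants of different colours at that point: then three concurrent secants do
    not form a triangle, and the graph has no K_4 ([secant_graph_K4_free]). For a
    random colouring, every set A of at least 8 q^2 secants still has average
    degree of order |A| / q ([exists_good_colouring], [exists_large_degree]).

    Take a set Y of vertices of this graph, or of a blow-up of it, in which the
    degrees are at most D. A container argument ([container_family]) covers Y, up
    to O(D q log q) points, by one of q^(O(q log q)) containers of size O(q^2).
    A map from n points to the q^4 vertices sends about n / q^2 points into a
    given container; for a random map, no container receives more than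
    O(n / q^2 + q (log q)^2) points ([exists_spread_map]). Pulling the graph
    back gives a K_4-free graph on n vertices with
       |Y| = O(n / q^2 + q (log q)^2 + D q log q)
    for every such set Y ([sparse_sets_small]).

    An F-free set of m vertices spans O(m^(1 + alpha)) edges, so half of its
    vertices have degree D = O(m^alpha) in it, and the bound applies to them. Let
    tau be the function of n in the theorem, and take q of order
    tau^(1 - alpha) / (log n)^2. Then n / q^2 and q (log q)^2 are O(tau), and the
    last term is O(tau^(1 - alpha) m^alpha). If m > tau, this term dominates, and
    m = O(tau^(1 - alpha) m^alpha) gives m = O(tau). *)

(** * The Hermitian curve has no O'Nan configuration *)

Local Open Scope ring_scope.

Section HermitianAlgebra.
Variables (F : fieldType) (s : {rmorphism F -> F}).
Implicit Types l P : F * F.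

(** The affine part of the Hermitian curve, in the form y^q + y = x^(q+1), where
    [s] is the map x |-> x^q. *)
Definition isotropic P := s P.2 + P.2 == s P.1 * P.1.

(** A pair [l = (m, b)] is the line y = m x + b. Vertical lines are left out: the
    others are numerous enough, and on them a point is determined by its
    abscissa. *)
Definition line_eval l P := P.2 - (l.1 * P.1 + l.2).
Definition on_line P l := line_eval l P == 0.

(** The Hermitian form of the curve, evaluated at the vectors (1, x, y). *)
Definition hform P Q := s Q.2 + P.2 - P.1 * s Q.1.

Lemma isotropicE P : isotropic P = (hform P P == 0).
Proof. by rewrite /isotropic /hform subr_eq0 [_ * s _]mulrC. Qed.

Lemma on_line_fst_inj l P Q :
  on_line P l -> on_line Q l -> P.1 = Q.1 -> P = Q.
Proof.
case: P Q => [x y] [x' y']; rewrite /on_line /line_eval /= !subr_eq0.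
by move=> /eqP-> /eqP-> ->.
Qed.

Lemma slope_inj l l' P : on_line P l -> on_line P l' -> l.1 = l'.1 -> l = l'.
Proof.
case: l l' => [m b] [m' b']; rewrite /on_line /line_eval /= !subr_eq0.
by move=> /eqP-> /eqP e e'; move: e; rewrite e' => /addrI->.
Qed.

Lemma on_line_uniq l l' P Q : l != l' ->
  on_line P l -> on_line P l' -> on_line Q l -> on_line Q l' -> P = Q.
Proof.
move=> ll' Pl Pl' Ql Ql'; apply: (on_line_fst_inj Pl Ql).
have ml : l.1 - l'.1 != 0.
  by apply: contra_neq ll' => /subr0_eq; apply: slope_inj Pl Pl'.
apply/eqP; rewrite -subr_eq0 -(mulrI_eq0 _ (mulfI ml)); apply/eqP.
move: Pl Pl' Ql Ql'; rewrite /on_line => /eqP e1 /eqP e2 /eqP e3 /eqP e4.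
transitivity (line_eval l' P - line_eval l P - (line_eval l' Q - line_eval l Q)).
  by rewrite /line_eval; ring.
by rewrite e1 e2 e3 e4 !subr0.
Qed.

(** In homogeneous coordinates, [D] is a combination of [B] and [C], whose
    coefficients are, up to a common factor, [line_eval l' C] and
    [- line_eval l' B] because [D] is on [l']. Expanding the form at [D], the
    diagonal terms vanish, and the two cross terms must cancel. So the form
    becomes antisymmetric on the three vertices of a triangle once each is divided
    by its value under [l']. *)
Lemma hform_swap l l' B C D :
    isotropic B -> isotropic C -> isotropic D ->
    on_line B l -> on_line C l -> on_line D l -> on_line D l' ->
    B != C -> line_eval l' B != 0 ->
  line_eval l' C * s (line_eval l' B) * hform B C
    = - (s (line_eval l' C) * line_eval l' B * hform C B).
Proof.
rewrite !isotropicE => /eqP iB /eqP iC /eqP iD Bl Cl Dl Dl' BC eB0.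
set eB := line_eval l' B; set eC := line_eval l' C.
(* [u] and [v] are the barycentric coordinates of [D], up to the factor [u + v]. *)
pose u := D.1 - C.1; pose v := B.1 - D.1.
have yE P : on_line P l -> P.2 = l.1 * P.1 + l.2 by move/eqP/subr0_eq.
have bary : u * eB = - (v * eC).
  apply/eqP; rewrite -subr_eq0 opprK; apply/eqP.
  transitivity ((u + v) * line_eval l' D); last by rewrite (eqP Dl') mulr0.
  by rewrite /u /v /eB /eC /line_eval !(yE _ Bl, yE _ Cl, yE _ Dl); ring.
have iso : u * s v * hform B C = - (v * s u * hform C B).
  apply/eqP; rewrite -subr_eq0 opprK; apply/eqP.
  transitivity ((u + v) * s (u + v) * hform D D
      - u * s u * hform B B - v * s v * hform C C); last first.
    by rewrite iB iC iD !mulr0 !subr0.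
  rewrite /hform /u /v !(yE _ Bl, yE _ Cl, yE _ Dl).
  by rewrite !(rmorphB, rmorphD, rmorphM) /=; ring.
have v0 : v != 0.
  apply: contra_neq BC => v0; apply: (on_line_fst_inj Bl Cl).
  have /eqP : u * eB = 0 by rewrite bary v0 mul0r oppr0.
  rewrite mulf_eq0 (negPf eB0) orbF => /eqP /subr0_eq <-.
  by move/subr0_eq: v0.
have sbary : s u * s eB = - (s v * s eC).
  by rewrite -!rmorphM -rmorphN bary.
have vv0 : v * s v != 0 by rewrite mulf_neq0 ?fmorph_eq0.
apply: (mulfI vv0); rewrite -/eB -/eC.
transitivity (- (u * s v * hform B C) * (eB * s eB)).
  transitivity (- (- (v * eC)) * (s v * s eB * hform B C)); first by ring.
  by rewrite -bary; ring.
rewrite iso opprK.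
transitivity (v * (s u * s eB) * eB * hform C B); first by ring.
by rewrite sbary; ring.
Qed.

(** Since the diagonal of the Gram matrix of three isotropic vectors is zero, its
    determinant has only the two terms on the left. It is also the product of the
    determinant [d] of the vectors (1, x, y), of its conjugate, and of the
    determinant of the form. *)
Lemma gram_det A B C : isotropic A -> isotropic B -> isotropic C ->
  let d := (B.1 - A.1) * (C.2 - A.2) - (C.1 - A.1) * (B.2 - A.2) in
  hform A B * hform B C * hform C A + hform B A * hform C B * hform A C
    = d * s d.
Proof.
rewrite /isotropic => /eqP iA /eqP iB /eqP iC /=.
have sE x y z : x + y = z -> x = z - y :> F by move=> <-; rewrite addrK.
rewrite /hform !(rmorphB, rmorphM) /= (sE _ _ _ iA) (sE _ _ _ iB) (sE _ _ _ iC).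
ring.
Qed.

(** O'Nan's theorem: four lines in general position cannot have all their six
    intersection points on the curve. By [hform_swap], after scaling, the Gram
    matrix of the triangle cut out by three of the lines is an antisymmetric 3 by 3
    matrix with zero diagonal, hence singular, whereas [gram_det] makes it
    nonsingular as the triangle is not degenerate. *)
Lemma no_onan l1 l2 l3 l4 A B C D E G :
    isotropic A -> isotropic B -> isotropic C ->
    isotropic D -> isotropic E -> isotropic G ->
    on_line A l2 -> on_line A l3 -> on_line B l1 -> on_line B l3 ->
    on_line C l1 -> on_line C l2 -> on_line D l1 -> on_line D l4 ->
    on_line E l2 -> on_line E l4 -> on_line G l3 -> on_line G l4 ->
    l2 != l3 -> A != B -> A != C -> B != C ->
    ~~ on_line A l4 -> ~~ on_line B l4 -> ~~ on_line C l4 -> False.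
Proof.
move=> iA iB iC iD iE iG A2 A3 B1 B3 C1 C2 D1 D4 E2 E4 G3 G4 l23 AB AC BC.
move=> nA nB nC.
have hBC := hform_swap iB iC iD B1 C1 D1 D4 BC nB.
have CA : C != A by rewrite eq_sym.
have hCA := hform_swap iC iA iE C2 A2 E2 E4 CA nC.
have hAB := hform_swap iA iB iG A3 B3 G3 G4 AB nA.
set eA := line_eval l4 A in hAB hCA nA.
set eB := line_eval l4 B in hAB hBC nB.
set eC := line_eval l4 C in hBC hCA nC.
have e0 : (eA * eB * eC) * s (eA * eB * eC) != 0.
  by rewrite mulf_neq0 ?fmorph_eq0 // !mulf_neq0.
have sum0 : hform A B * hform B C * hform C A
            + hform B A * hform C B * hform A C = 0.
  apply: (mulfI e0); rewrite mulr0 !rmorphM.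
  transitivity ((eB * s eA * hform A B) * (eC * s eB * hform B C)
      * (eA * s eC * hform C A)
      + (s eB * eA * hform B A) * (s eC * eB * hform C B)
      * (s eA * eC * hform A C)); first by ring.
  by rewrite hAB hBC hCA; ring.
have := gram_det iA iB iC; rewrite sum0 => /esym/eqP.
rewrite mulf_eq0 fmorph_eq0 orbb => /eqP d0.
have yE P l : on_line P l -> P.2 = l.1 * P.1 + l.2 by move/eqP/subr0_eq.
have /eqP : (B.1 - A.1) * (C.1 - A.1) * (l2.1 - l3.1) = 0.
  transitivity ((B.1 - A.1) * (l2.1 * C.1 + l2.2 - (l2.1 * A.1 + l2.2))
      - (C.1 - A.1) * (l3.1 * B.1 + l3.2 - (l3.1 * A.1 + l3.2))); first by ring.
  by rewrite -(yE _ _ C2) -(yE _ _ A2) -(yE _ _ B3) -(yE _ _ A3).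
rewrite !mulf_eq0 !subr_eq0 => /orP[/orP[]|] /eqP e.
- by case/eqP: AB; apply: on_line_fst_inj A3 B3 _.
- by case/eqP: AC; apply: on_line_fst_inj A2 C2 _.
- by case/eqP: l23; apply: slope_inj A2 A3 e.
Qed.

End HermitianAlgebra.

(** * Counting points and secants *)

Section Counting.
Variables (F : finFieldType) (s : {rmorphism F -> F}) (q : nat).
Hypotheses (q_gt1 : (1 < q)%N) (card_F : #|F| = (q ^ 2)%N).
Hypothesis sE : forall x, s x = x ^+ q.

Lemma card_roots_le (p : {poly F}) (n : nat) :
  p != 0 -> (size p <= n.+1)%N -> (#|[set x | root p x]| <= n)%N.
Proof.
move=> p0 sp; rewrite cardE -ltnS; apply: leq_trans sp.
apply: max_poly_roots => //; first by apply/allP=> x; rewrite mem_enum inE.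
exact: enum_uniq.
Qed.

Lemma card_trace_fiber (c : F) : (#|[set y | (s y + y == c)%R]| <= q)%N.
Proof.
pose p : {poly F} := 'X^q + ('X - c%:P).
have sp : size p = q.+1.
  by rewrite size_polyDl size_polyXn // size_XsubC.
have := @card_roots_le p q; rewrite sp -size_poly_eq0 sp => /(_ isT (leqnn _)).
apply: leq_trans; apply/subset_leq_card/subsetP=> y; rewrite !inE => /eqP yc.
rewrite /root !hornerE -yc sE; apply/eqP; exact: subrr.
Qed.

Lemma card_norm_fiber_le (c : F) : (#|[set x | (s x * x == c)%R]| <= q.+1)%N.
Proof.
pose p : {poly F} := 'X^(q.+1) + (- c)%:P.
have sp : size p = q.+2.
  by rewrite size_polyDl size_polyXn // (leq_ltn_trans (size_polyC_leq1 _)).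
have := @card_roots_le p q.+1; rewrite sp -size_poly_eq0 sp => /(_ isT (leqnn _)).
apply: leq_trans; apply/subset_leq_card/subsetP=> y; rewrite !inE => /eqP yc.
rewrite /root !hornerE -yc sE -exprSr; apply/eqP; exact: subrr.
Qed.

Lemma inj_pair (x : F) : injective (fun y : F => (x, y)).
Proof. by move=> y y' []. Qed.

Lemma conjK : involutive s.
Proof. by move=> x; rewrite !sE -exprM mulnn -card_F expf_card. Qed.

(** Each of the q - 1 possible nonzero norms has at most q + 1 preimages, and the
    q^2 - 1 nonzero elements have to be distributed among them, so there is
    equality everywhere. *)
Lemma card_norm_fiber (c : F) : c != 0 -> s c = c ->
  (#|[set x | (s x * x == c)%R]| = q.+1)%N.
Proof.
move=> c0 sc; apply/eqP; rewrite eqn_leq card_norm_fiber_le /=.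
pose K := [set c : F | (c != 0) && (s c == c)].
have cK : c \in K by rewrite inE c0 sc eqxx.
(* Norms are fixed by [s], hence roots of 'X^q - 'X, and 0 is another root. *)
have K_le : (#|K| <= q.-1)%N.
  have := @card_roots_le ('X^q - 'X) q.
  rewrite -size_poly_eq0 size_polyDl ?size_polyXn ?size_polyN ?size_polyX //.
  move=> /(_ isT (leqnn _)) h; rewrite -ltnS prednK; last by case: q q_gt1.
  apply: leq_trans h; apply: proper_card; apply/properP; split.
    apply/subsetP=> x; rewrite !inE => /andP[_ /eqP sx].
    by rewrite /root !hornerE -sE sx subrr.
  by exists 0; rewrite !inE ?eqxx // /root !hornerE expr0n gtn_eqF ?subr0 // ltnW.
have tot : (q ^ 2 = 1 + \sum_(c in K) #|[set x | (s x * x == c)%R]|)%N.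
  rewrite -card_F (cardD1 0) inE; congr (_ + _)%N.
  rewrite -sum1_card.
  rewrite (partition_big (fun x => s x * x) (mem K)) /=.
    apply: eq_bigr => d; rewrite inE => /andP[d0 _].
    rewrite sum1_card; apply: eq_card => x; rewrite !inE unfold_in !inE.
    by case: eqVneq => [->|//]; rewrite mulr0 [RHS]eq_sym (negPf d0).
  move=> x; rewrite !inE andbT => x0; rewrite mulf_neq0 ?fmorph_eq0 //=.
  by rewrite rmorphM conjK mulrC.
rewrite (bigD1 c) //= in tot.
have : (\sum_(i in K | i != c) #|[set x | (s x * x == i)%R]| <= #|K|.-1 * q.+1)%N.
  rewrite (cardD1 c) cK /= -sum_nat_const.
  rewrite [leqRHS](eq_bigl (fun i => (i \in K) && (i != c))); last first.
    by move=> i; rewrite !inE andbC.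
  by apply: leq_sum => i _; apply: card_norm_fiber_le.
move: tot; set N := #|_|; set S := (\sum_(i in K | _) _)%N => tot S_le.
have {S_le K_le} : (S <= (q - 2) * q.+1)%N.
  by apply: leq_trans S_le _; rewrite leq_mul2r; lia.
move: tot q_gt1; clearbody N S; clear; case: q => [|[|r]] //= tot _ S_le.
rewrite -mulnn in tot; nia.
Qed.

Definition unital_point := {P : F * F | isotropic s P}.

(** A line whose equation reduces to N(x - s m) = c with c nonzero; for c = 0 it
    is tangent to the curve. *)
Definition secant := {l : F * F | s l.2 + l.2 + s l.1 * l.1 != 0}.
Definition incident (P : unital_point) (l : secant) := on_line (val P) (val l).

Lemma card_fibered (p : pred (F * F)) :
  (forall x, #|[set y | p (x, y)]| <= q)%N -> (#|[set P | p P]| <= q ^ 3)%N.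
Proof.
move=> h; rewrite -sum1_card.
rewrite (partition_big (fun P => P.1) predT) //=.
rewrite (expnS q 2) mulnC -card_F -sum_nat_const; apply: leq_sum => x _.
apply: leq_trans (h x); rewrite sum1_card.
rewrite -(card_imset (mem [set y | p (x, y)]) (@inj_pair x)).
apply/subset_leq_card/subsetP => -[x' y] /=.
rewrite unfold_in inE /= => /andP[py /eqP xx].
by apply/imsetP; exists y; rewrite ?inE -?xx.
Qed.

Lemma card_unital_point : (#|{: unital_point}| <= q ^ 3)%N.
Proof.
rewrite card_sig -(cardsE (isotropic s)); apply: card_fibered => x.
by apply: leq_trans (card_trace_fiber (s x * x)); apply: subset_leq_card.
Qed.

Lemma card_secant_le : (#|{: secant}| <= q ^ 4)%N.
Proof.
by rewrite card_sig (expnM q 2 2) -card_F (leq_trans (max_card _)) // card_prod mulnn.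
Qed.

Lemma card_secant_ge : (q ^ 4 - q ^ 3 <= #|{: secant}|)%N.
Proof.
rewrite leq_subLR card_sig.
set p := (fun l : F * F => _).
rewrite (expnM q 2 2) -card_F -mulnn -card_prod -(cardC p) addnC leq_add2r.
rewrite -cardsE; apply: card_fibered => x.
apply: leq_trans (card_trace_fiber (- (s x * x))).
apply/subset_leq_card/subsetP => y; rewrite !inE /p /= negbK.
by rewrite addr_eq0.
Qed.

Lemma card_incident (l : secant) : (q <= #|[set P | incident P l]|)%N.
Proof.
case: l => -[m b] /= lP; set l : secant := exist _ _ _.
pose c := s b + b + s m * m; have c0 : c != 0 := lP.
have sc : s c = c by rewrite /c !(rmorphD, rmorphM) /= !conjK; ring.
(* Translated by [s m], the equation of the line becomes a norm equation. *)
have iso (x : F) : s x * x == c -> isotropic s (x + s m, m * (x + s m) + b).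
  move=> /eqP xc; rewrite /isotropic /= -subr_eq0; apply/eqP.
  rewrite !(rmorphD, rmorphM) /= !conjK.
  transitivity (c - s x * x); last by rewrite xc subrr.
  by rewrite /c; ring.
pose f (x : {x | s x * x == c}) : unital_point :=
  exist (fun P => isotropic s P) _ (iso _ (valP x)).
have f_inj : injective f.
  by move=> x y [/addIr xy _]; apply: val_inj.
apply: ltnW; rewrite -(card_norm_fiber c0 sc) cardsE -card_sig -(card_imset _ f_inj).
apply/subset_leq_card/subsetP => _ /imsetP[x _ ->].
by rewrite inE /incident /on_line /line_eval /= subrr.
Qed.

End Counting.

(** What the graph below uses of the geometry of the unital. In [onan_free],
    [p_ij] is the common point of [l_i] and [l_j]; the lines 1, 2
    and 3 form a triangle, and the line 4 avoids its vertices. *)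
Record onan_free_space (P L : finType) (inc : P -> L -> bool) := OnanFreeSpace {
  lines_meet_once : forall l l' p p', l != l' ->
    inc p l -> inc p l' -> inc p' l -> inc p' l' -> p = p';
  onan_free : forall (l1 l2 l3 l4 : L) (p12 p13 p14 p23 p24 p34 : P),
    inc p12 l1 -> inc p12 l2 -> inc p13 l1 -> inc p13 l3 ->
    inc p14 l1 -> inc p14 l4 -> inc p23 l2 -> inc p23 l3 ->
    inc p24 l2 -> inc p24 l4 -> inc p34 l3 -> inc p34 l4 ->
    l2 != l3 -> p12 != p13 -> p12 != p23 -> p13 != p23 ->
    ~~ inc p12 l4 -> ~~ inc p13 l4 -> ~~ inc p23 l4 -> False }.

(** Consecutive powers of 2 differ by a factor 2, so restricting the order of the
    unital to them only changes constants. *)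
Lemma hermitian_unital (k : nat) (q := (2 ^ k)%N) : (0 < k)%N ->
  exists (P L : finType) (inc : P -> L -> bool),
    [/\ onan_free_space inc, (#|P| <= q ^ 3)%N,
        (q ^ 4 - q ^ 3 <= #|L|)%N, (#|L| <= q ^ 4)%N &
        forall l, (q <= #|[set p | inc p l]|)%N].
Proof.
move=> k0; have k2_gt0 : (0 < 2 * k)%N by rewrite muln_gt0.
have [F chF cardF] := @pPrimePowerField 2 (2 * k) isT k2_gt0.
have card_F : #|F| = (q ^ 2)%N by rewrite cardF mulnC expnM.
have q_nat : [pchar F].-nat q by rewrite pnatX; apply/orP; left; rewrite pnatE.
pose f (x : F) := x ^+ q.
have fB : zmod_morphism f by move=> x y; rewrite /f exprDn_pchar // exprNn_pchar.
have fM : monoid_morphism f.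
  by split=> [|x y]; rewrite /f ?expr1n ?exprMn.
pose s : {rmorphism F -> F} := HB.pack f
  (GRing.isZmodMorphism.Build F F f fB) (GRing.isMonoidMorphism.Build F F f fM).
have q_gt1 : (1 < q)%N by rewrite -(expn0 2) ltn_exp2l.
have sE x : s x = x ^+ q by [].
exists (unital_point s), (secant s), (@incident _ s); split.
- split.
    move=> l l' p p' ll' pl pl' p'l p'l'; apply: val_inj.
    exact: (on_line_uniq (_ : val l != val l')) p'l p'l'.
  move=> l1 l2 l3 l4 p12 p13 p14 p23 p24 p34 h1 h2 h3 h4 h5 h6 h7 h8 h9 h10 h11 h12.
  move=> l23 n1 n2 n3 m1 m2 m3.
  apply: (no_onan (valP p23) (valP p13) (valP p12) (valP p14) (valP p24) (valP p34)
    h7 h8 h3 h4 h1 h2 h5 h6 h9 h10 h11 h12) => //; by rewrite val_eqE // eq_sym.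
- exact: card_unital_point q_gt1 card_F sE.
- exact: card_secant_ge q_gt1 card_F sE.
- exact: card_secant_le card_F.
- exact: card_incident q_gt1 card_F sE.
Qed.

(** * Random colourings of the incidences *)

(** The exponential moment of a sum of independent variables is the product of
    their moments: for a uniformly random [f], the events [Q i (f i)] are
    independent. *)
Lemma sum_exp_card (R : comNzSemiRingType) (I J : finType) (Q : I -> J -> bool) (x : R) :
  \sum_(f : {ffun I -> J}) x ^+ #|[set i | Q i (f i)]|
    = \prod_(i : I) \sum_(j : J) x ^+ Q i j.
Proof.
rewrite bigA_distr_bigA; apply: eq_bigr => f _.
rewrite -sum1dep_card big_mkcond /= expr_sum.
by apply: eq_bigr => i _; case: (Q i (f i)).
Qed.

Lemma sum_exp_set (R : comNzSemiRingType) (I : finType) (x : R) :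
  \sum_(A : {set I}) x ^+ #|A| = (1 + x) ^+ #|I|.
Proof.
rewrite addrC -[in RHS]prodr_const (bigA_distr _ _ (fun=> x) (fun=> 1)) /=.
by apply: eq_bigr => A _; rewrite -prodr_const big_mkcond.
Qed.

Lemma exp1D_le (R : realFieldType) (n : nat) (x : R) : 0 <= x ->
  n%:R * x <= 1 / 2 -> (1 + x) ^+ n <= 1 + 2 * (n%:R * x).
Proof.
move=> x0; elim: n => [|n IHn]; first by rewrite expr0 mul0r mulr0 addr0.
rewrite -natr1 => nx; have {IHn} := IHn ltac:(nra).
rewrite exprS => /(ler_wpM2l (_ : 0 <= 1 + x)) h; apply: (le_trans (h _)); first lra.
nra.
Qed.

Section Colouring.
Variables (P L : finType) (inc : P -> L -> bool).

(** The incidences of lines of [A] at which [chi] differs from a colour chosen for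
    each point; the choice of the majority colour counts the minorities. *)
Definition off_colour (chi : {ffun P * L -> bool}) (b : {ffun P -> bool}) (A : {set L}) :=
  [set u : P * L | [&& inc u.1 u.2, u.2 \in A & chi u != b u.1]].

Lemma card_flags (s : nat) (A : {set L}) :
  (forall l, (s <= #|[set p | inc p l]|)%N) ->
  (s * #|A| <= #|[set u : P * L | inc u.1 u.2 && (u.2 \in A)]|)%N.
Proof.
move=> h; rewrite mulnC -sum_nat_const -[leqRHS]sum1dep_card.
rewrite (partition_big (fun u : P * L => u.2) (mem A)) /=; last first.
  by move=> u /andP[].
apply: leq_sum => l lA; apply: leq_trans (h l) _.
rewrite sum1_card -(card_imset _ (fun p p' => (fun e : (p, l) = (p', l) => congr1 fst e))).
apply/subset_leq_card/subsetP => _ /imsetP[p + ->].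
by rewrite inE unfold_in /= => ->; rewrite lA eqxx.
Qed.

Lemma sum_half_off_colour (R : realFieldType) (s : nat) b A :
  (forall l, (s <= #|[set p | inc p l]|)%N) ->
  \sum_(chi : {ffun P * L -> bool}) (1 / 2 : R) ^+ #|off_colour chi b A|
    <= 2 ^+ #|{: P * L}| * (3 / 4) ^+ (s * #|A|).
Proof.
move=> /(card_flags A) sA.
rewrite (sum_exp_card (fun u c => [&& inc u.1 u.2, u.2 \in A & c != b u.1])).
rewrite (eq_bigr (fun u => 2 * (if inc u.1 u.2 && (u.2 \in A) then 3 / 4 else 1))); last first.
  move=> u _; rewrite big_bool /=.
  by case: (inc _ _); case: (_ \in A); case: (b u.1) => //=; rewrite ?expr0 ?expr1; lra.
rewrite big_split /= prodr_const -big_mkcond /= prodr_const ler_wpM2l ?exprn_ge0 //.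
apply: ler_wiXn2l; [lra|lra|].
apply: (leq_trans sA); apply: subset_leq_card; apply/subsetP=> u.
by rewrite inE unfold_in.
Qed.

(** Union bound over all [A] and [b], in one computation: each pair contributes
    [2 ^ (d * #|A|)] times the moment of [(1 / 2) ^ #|off_colour chi b A|], which
    is at most [(3 / 4) ^ (s * #|A|)]. There are [2 ^ #|P|] choices of [b], which
    cost [2 ^ (e * #|A|)] as [A] is large. The last hypothesis says that what is
    left is at most [(1 / (2 * #|L|)) ^ #|A|], so that the sum over nonempty [A]
    is at most 1 on average, whereas a bad colouring makes it exceed 1. *)
Lemma exists_good_colouring (M s d e : nat) :
    (0 < M)%N -> (#|P| <= e * M)%N ->
    (forall l, (s <= #|[set p | inc p l]|)%N) ->
    (2 * #|L| * 2 ^ (d + e) * 3 ^ s <= 4 ^ s)%N ->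
  exists chi : {ffun P * L -> bool}, forall (b : {ffun P -> bool}) (A : {set L}),
    (M <= #|A|)%N -> (d * #|A| <= #|off_colour chi b A|)%N.
Proof.
move=> M0 PM sP num.
(* any ordered field can carry the computation *)
have [R _] : exists R : realFieldType, True by exists rat.
have le0_half : 0 <= 1 / 2 :> R by lra.
have le0_3_4 : 0 <= 3 / 4 :> R by lra.
pose good chi := [forall b : {ffun P -> bool}, [forall A : {set L},
   (M <= #|A|)%N ==> (d * #|A| <= #|off_colour chi b A|)%N]].
case: (pickP good) => [chi /forallP gchi|nogood].
  by exists chi => b A; move/forallP: (gchi b) => /(_ A) /implyP.
pose w chi (b : {ffun P -> bool}) (A : {set L}) : R :=
  2 ^+ (d * #|A|) * (1 / 2) ^+ #|off_colour chi b A|.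
pose Phi chi := \sum_(A : {set L} | (M <= #|A|)%N) \sum_b w chi b A.
have w_ge0 chi b A : 0 <= w chi b A by rewrite mulr_ge0 ?exprn_ge0.
have Phi_gt1 chi : 1 < Phi chi.
  have /forallPn[b /forallPn[A]] := negbT (nogood chi).
  rewrite negb_imply -ltnNge => /andP[MA lt].
  rewrite /Phi (bigD1 A) //= (bigD1 b) //=.
  rewrite -addrA ltr_wpDr //; last first.
    rewrite /w -(subnKC (ltnW lt)) exprD mulrAC -exprMn.
    rewrite mul1r mulfV ?pnatr_eq0 // expr1n mul1r exprn_egt1 ?ltr1n //.
    by rewrite -lt0n subn_gt0.
  by rewrite addr_ge0 // sumr_ge0 // => *; rewrite ?sumr_ge0.
(* [x ^+ #|A|] bounds the average contribution of [A]. *)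
pose x : R := 2 ^+ (d + e) * (3 / 4) ^+ s.
have x0 : 0 <= x by rewrite mulr_ge0 ?exprn_ge0.
have xL : #|L|%:R * x <= 1 / 2.
  have : (2 * #|L| * 2 ^ (d + e) * 3 ^ s)%:R <= (4 ^ s)%:R :> R by rewrite ler_nat.
  rewrite !natrM !natrX => h.
  rewrite /x expr_div_n ler_pdivlMr //.
  rewrite [leLHS](_ : _ = (2 * #|L|%:R * 2 ^+ (d + e) * 3 ^+ s) / 4 ^+ s).
    by rewrite ler_pdivrMr ?exprn_gt0 // mul1r.
  by rewrite mulrC !mulrA.
have step (A : {set L}) : (M <= #|A|)%N -> \sum_chi \sum_b w chi b A <= 2 ^+ #|{: P * L}| * x ^+ #|A|.
  move=> MA; rewrite exchange_big /=.
  apply: (@le_trans _ _ (\sum_(b : {ffun P -> bool})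
     2 ^+ (d * #|A|) * (2 ^+ #|{: P * L}| * (3 / 4) ^+ (s * #|A|)))).
    apply: ler_sum => b _; rewrite -mulr_sumr ler_wpM2l ?exprn_ge0 //.
    exact: sum_half_off_colour.
  rewrite sumr_const card_ffun card_bool -[X in X <= _]mulr_natl natrX.
  rewrite /x [(_ * _ ^+ s) ^+ _]exprMn -!exprM mulnDl exprD.
  rewrite [leRHS](_ : _ = 2 ^+ (e * #|A|) * (2 ^+ (d * #|A|) *
     (2 ^+ #|{: P * L}| * (3 / 4) ^+ (s * #|A|)))); last by ring.
  rewrite ler_wpM2r ?mulr_ge0 ?exprn_ge0 //.
  rewrite ler_weXn2l ?ler1n // (leq_trans PM) // leq_mul2l MA orbT //.
have : \sum_chi Phi chi <= 2 ^+ #|{: P * L}| * (\sum_(A : {set L}) x ^+ #|A| - 1).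
  rewrite exchange_big /= [X in _ * (X - _)](bigD1 set0) //= cards0 expr0 addrAC subrr add0r.
  rewrite mulr_sumr big_mkcond [leRHS]big_mkcond /=.
  apply: ler_sum => A _; case: ifP => MA; last first.
    by case: ifP => // _; rewrite mulr_ge0 ?exprn_ge0.
  rewrite -card_gt0 (leq_trans M0 MA); exact: step.
rewrite sum_exp_set => le1.
have : \sum_(chi : {ffun P * L -> bool}) 1 < \sum_chi Phi chi.
  apply: ltr_sum => //; apply/hasP; exists [ffun=> true]; rewrite ?mem_index_enum //.
rewrite sumr_const card_ffun card_bool natrX => lt1.
have := lt_le_trans lt1 le1; have := exp1D_le x0 xL.
set y := 2 ^+ _; have : 0 < y by rewrite exprn_gt0.
nra.
Qed.

End Colouring.

Local Close Scope ring_scope.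

(** * A dense graph without K_4 *)

Lemma sum_sqr_le (I : finType) (m : I -> nat) :
  ((\sum_i m i) ^ 2 <= #|I| * \sum_i m i ^ 2)%N.
Proof.
rewrite -(leq_pmul2l (isT : 0 < 2)) -mulnn big_distrlr /=.
rewrite -[#|I| * _]sum_nat_const [2 * (\sum_(_ in _) _)%N]mul2n -addnn.
rewrite [X in _ <= X + _](eq_bigr (fun=> \sum_j m j ^ 2)) //.
rewrite [X in _ <= X + _]exchange_big -big_split big_distrr /=.
apply: leq_sum => i _; rewrite -big_split big_distrr /=.
by apply: leq_sum => j _; rewrite nat_Cauchy.
Qed.

Section ColouredLines.
Variables (P L : finType) (inc : P -> L -> bool) (chi : {ffun P * L -> bool}).
Hypothesis inc_spec : onan_free_space inc.

(** The lines through a point would form a clique; keeping only the pairs of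
    different colours at that point turns the clique into a bipartite graph. *)
Definition bichromatic (l l' : L) :=
  [exists p, [&& inc p l, inc p l' & chi (p, l) != chi (p, l')]].

Lemma bichromatic_sym : symmetric bichromatic.
Proof.
move=> l l'; apply: eq_existsb => p.
by rewrite eq_sym; case: (inc p l); case: (inc p l').
Qed.

Lemma bichromatic_irrefl : irreflexive bichromatic.
Proof. by move=> l; apply/existsP => -[p]; rewrite eqxx !andbF. Qed.

Definition secant_graph := SGraph bichromatic_sym bichromatic_irrefl.

(** If three of four pairwise adjacent lines were concurrent, their colours at the
    common point would be three different booleans. Otherwise the four lines are
    the configuration excluded by [onan_free]. *)
Lemma secant_graph_K4_free : Defs.free (complete 4) secant_graph.
Proof.
move=> [f f_inj f_adj].
have adjf (i j : 'I_4) : i != j -> bichromatic (f i) (f j) by apply: f_adj.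
have neq (i j : 'I_4) : i != j -> f i != f j by rewrite (inj_eq f_inj).
(* three pairwise adjacent lines are never concurrent *)
have conc (i j k : 'I_4) p : i != j -> i != k -> j != k ->
    inc p (f i) -> inc p (f j) -> inc p (f k) -> False.
  have diff a b : a != b -> inc p (f a) -> inc p (f b) ->
      chi (p, f a) != chi (p, f b).
    move=> ab pa pb; have /existsP[p' /and3P[p'a p'b]] := adjf _ _ ab.
    by rewrite (lines_meet_once inc_spec (neq _ _ ab) p'a p'b pa pb).
  move=> ij ik jk pi pj pk; move: (diff _ _ ij pi pj) (diff _ _ ik pi pk) (diff _ _ jk pj pk).
  by case: (chi (p, f i)); case: (chi (p, f j)); case: (chi (p, f k)).
pose i1 : 'I_4 := inord 0; pose i2 : 'I_4 := inord 1.
pose i3 : 'I_4 := inord 2; pose i4 : 'I_4 := inord 3.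
have e12 : i1 != i2 by rewrite -val_eqE /= !inordK.
have e13 : i1 != i3 by rewrite -val_eqE /= !inordK.
have e14 : i1 != i4 by rewrite -val_eqE /= !inordK.
have e23 : i2 != i3 by rewrite -val_eqE /= !inordK.
have e24 : i2 != i4 by rewrite -val_eqE /= !inordK.
have e34 : i3 != i4 by rewrite -val_eqE /= !inordK.
have /existsP[p12 /and3P[a1 a2 _]] := adjf _ _ e12.
have /existsP[p13 /and3P[b1 b3 _]] := adjf _ _ e13.
have /existsP[p14 /and3P[c1 c4 _]] := adjf _ _ e14.
have /existsP[p23 /and3P[d2 d3 _]] := adjf _ _ e23.
have /existsP[p24 /and3P[g2 g4 _]] := adjf _ _ e24.
have /existsP[p34 /and3P[h3 h4 _]] := adjf _ _ e34.
apply: (onan_free inc_spec a1 a2 b1 b3 c1 c4 d2 d3 g2 g4 h3 h4 (neq _ _ e23)).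
- by apply/eqP => e; rewrite -e in b3; apply: (conc _ _ _ _ e12 e13 e23 a1 a2 b3).
- by apply/eqP => e; rewrite -e in d3; apply: (conc _ _ _ _ e12 e13 e23 a1 a2 d3).
- by apply/eqP => e; rewrite -e in d2; apply: (conc _ _ _ _ e12 e13 e23 b1 d2 b3).
- by apply/negP => e; apply: (conc _ _ _ _ e12 e14 e24 a1 a2 e).
- by apply/negP => e; apply: (conc _ _ _ _ e13 e14 e34 b1 b3 e).
- by apply/negP => e; apply: (conc _ _ _ _ e23 e24 e34 d2 d3 e).
Qed.

Section Degree.
Variable A : {set L}.
Let X c p := [set l in A | inc p l & chi (p, l) == c].

(** Two lines meet only once, so the edges given by different points are
    different. *)
Lemma sum_colour_products_le :
  \sum_p #|X true p| * #|X false p| <= \sum_(l in A) #|[set l' in A | bichromatic l l']|.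
Proof.
pose S := [set u : P * (L * L) | (u.2.1 \in X true u.1) && (u.2.2 \in X false u.1)].
have -> : \sum_p #|X true p| * #|X false p| = #|S|.
  rewrite -[RHS]sum1dep_card (partition_big (fun u => u.1) predT) //=.
  apply: eq_bigr => p _; rewrite -cardsX sum1_card.
  rewrite -(card_imset (mem (setX _ _)) (fun u v => (fun e : (p, u) = (p, v) => congr1 snd e))).
  apply: eq_card => -[p' [l l']]; rewrite unfold_in /=.
  apply/imsetP/andP => [[[m m'] + [-> -> ->]]|[/andP[h1 h2] /eqP <-]].
    by rewrite in_setX /= => ->.
  by exists (l, l'); rewrite // in_setX h1 h2.
have -> : \sum_(l in A) #|[set l' in A | bichromatic l l']| =
    #|[set u : L * L | [&& u.1 \in A, u.2 \in A & bichromatic u.1 u.2]]|.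
  rewrite -[RHS]sum1dep_card (partition_big (fun u => u.1) (mem A)) /=; last by move=> u /andP[].
  apply: eq_bigr => l lA; rewrite sum1_card.
  rewrite -(card_imset _ (fun u v => (fun e : (l, u) = (l, v) => congr1 snd e))).
  apply: eq_card => -[m m']; rewrite unfold_in /=.
  apply/imsetP/andP => [[l' + [-> ->]]|[/and3P[h1 h2 h3] /eqP e]].
    by rewrite inE lA eqxx => ->.
  by exists m'; rewrite ?inE ?h2 -?e.
rewrite -(card_in_imset (f := fun u : P * (L * L) => u.2) (D := mem S)).
  apply/subset_leq_card/subsetP => _ /imsetP[[p [l l']] + ->]; rewrite !inE /=.
  move=> /andP[/and3P[lA pl /eqP cl] /and3P[l'A pl' /eqP cl']].
  by rewrite lA l'A; apply/existsP; exists p; rewrite pl pl' cl cl'.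
move=> [p u] [p' u'] + + /= e; rewrite -{}e !inE /=.
move=> /andP[/and3P[_ pl /eqP cl] /and3P[_ pl' /eqP cl']].
move=> /andP[/and3P[_ p'l _] /and3P[_ p'l' _]].
congr (_, _); apply: (lines_meet_once inc_spec _ pl pl' p'l p'l').
by apply: contra_eq_neq cl => ->; rewrite cl'.
Qed.

Definition majority : {ffun P -> bool} := [ffun p => #|X false p| <= #|X true p|].

Lemma card_off_majority :
  #|off_colour inc chi majority A| = \sum_p minn #|X true p| #|X false p|.
Proof.
rewrite -[LHS]sum1dep_card (partition_big (fun u => u.1) predT) //=.
apply: eq_bigr => p _; rewrite sum1_card.
transitivity #|X (~~ majority p) p|; last first.
  by rewrite ffunE; case: leqP.
rewrite -[RHS](card_imset _ (fun u v => (fun e : (p, u) = (p, v) => congr1 snd e))).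
apply: eq_card => -[p' l]; rewrite unfold_in /=.
apply/andP/imsetP => [[/and3P[h1 h2 h3] /eqP e]|[l' + [-> ->]]].
  exists l; rewrite -e // inE h2 h1 /=.
  by move: h3; case: (chi _); case: (majority _).
rewrite inE => /and3P[-> -> /eqP ->]; rewrite eqxx; by case: (majority p).
Qed.

(** At each point the product of the two colour classes is at least the square of
    the smaller one. The sum of the smaller ones is at least [d * #|A|], so by
    Cauchy-Schwarz the average degree in [A] is at least
    [d ^ 2 * #|A| / #|P|]. *)
Lemma exists_large_degree (d : nat) : 0 < #|A| ->
    (forall b, d * #|A| <= #|off_colour inc chi b A|) ->
  exists2 v, v \in A & d ^ 2 * #|A| <= #|P| * #|[set u in A | bichromatic v u]|.
Proof.
move=> A0 good; apply/exists_inP; apply: contraT; rewrite negb_exists_in => /forall_inP small.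
have : d ^ 2 * #|A| * #|A| <= #|P| * \sum_(l in A) #|[set l' in A | bichromatic l l']|.
  apply: leq_trans (leq_mul (leqnn _) sum_colour_products_le).
  apply: (@leq_trans (#|P| * \sum_p (minn #|X true p| #|X false p|) ^ 2)).
    apply: leq_trans (sum_sqr_le _); rewrite -card_off_majority -mulnA mulnn -expnMn.
    by rewrite leq_exp2r.
  rewrite leq_mul2l leq_sum ?orbT // => p _.
  by rewrite -mulnn leq_mul ?geq_minl ?geq_minr.
rewrite leqNgt => /negP[].
rewrite [X in _ < X]mulnC -sum_nat_const big_distrr /=.
have [v vA] := card_gt0P A0.
rewrite (bigD1 v) //= [X in _ < X](bigD1 v) //= -addSn leq_add //.
  by rewrite ltnNge small.
by apply: leq_sum => u /andP[uA _]; rewrite ltnW // ltnNge small.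
Qed.

End Degree.
End ColouredLines.

(** * Containers *)

Lemma leq_expn k m n : m <= n -> m ^ k <= n ^ k.
Proof. by case: k => // k mn; rewrite leq_exp2r. Qed.

(** The container argument of Kleitman and Winston, for sets of small degree
    instead of independent sets. As long as [A] is large it has a vertex [v] of
    large degree. If [v] is not in the image of [Y], it can be dropped at no cost.
    If [v] is the image of a point of [Y], then [Y] has at most [D] points over
    the neighbours of [v]; these are given up, and [A] shrinks by a factor
    [1 - 1 / D0]. The second case occurs at most [k] times, and the number of
    runs satisfies the recursion of [(#|A| + 1) ^ k]. Sets over an arbitrary map
    [f] are needed because the final graph is a blow-up. *)
Lemma container_family (V : finType) (e : rel V) (M D0 : nat) : 0 < D0 ->
    (forall A : {set V}, M < #|A| ->
       exists2 v, v \in A & #|A| <= D0 * #|[set u in A | e v u]|) ->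
  forall k (A : {set V}), #|A| * D0.-1 ^ k <= M * D0 ^ k ->
  exists CC : seq {set V},
    [/\ size CC <= #|A|.+1 ^ k, {in CC, forall C : {set V}, #|C| <= M} &
     forall (T : finType) (f : T -> V) (Y : {set T}) (D : nat),
       {in Y, forall y, #|[set y' in Y | e (f y) (f y')]| <= D} ->
       exists2 C, C \in CC & #|[set y in Y | f y \in A :\: C]| <= k * D].
Proof.
move=> D0_gt0 dense k A; move: {2}#|A| (leqnn #|A|) => n.
elim: n k A => [|n IHn] k A An hA; case: (leqP #|A| M) => [AM|MA].
1,3: exists [:: A]; split=> [|C|T f Y D _]; rewrite ?expn_gt0 ?inE //=; first by move/eqP->.
1,2: by exists A; rewrite ?inE // setDv eq_card0 // => y; rewrite !inE andbF.
  by move: MA; rewrite ltnNge (leq_trans An).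
have [v vA deg_v] := dense _ MA; set N := [set u in A | e v u] in deg_v.
have NA : N \subset A by apply/subsetP=> u; rewrite inE => /andP[].
have cardN : #|A :\: N| + #|N| = #|A| by rewrite addnC -(cardsID N A) (setIidPr NA).
have N_gt0 : 0 < #|N|.
  by rewrite lt0n; apply: contraL deg_v => /eqP ->; rewrite muln0 -ltnNge (leq_ltn_trans _ MA).
case: k hA => [|k] hA; first by move: hA; rewrite !muln1 leqNgt MA.
have cardv : #|A| = #|A :\ v|.+1 by rewrite (cardsD1 v) vA.
have [||CC1 [s1 M1 c1]] := IHn k.+1 (A :\ v).
- by rewrite -ltnS -cardv.
- by apply: leq_trans hA; rewrite leq_mul2r cardv leqnSn orbT.
have [||CC2 [s2 M2 c2]] := IHn k (A :\: N).
- by rewrite -ltnS; apply: leq_trans An; rewrite -cardN; lia.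
- rewrite -(leq_pmul2l D0_gt0) [X in _ <= X]mulnCA -expnS; apply: leq_trans hA.
  rewrite expnS !mulnA leq_mul2r; apply/orP; right.
  by move: D0_gt0 deg_v; rewrite -cardN; clear; case: D0 => //= D1 _; nia.
exists (CC1 ++ CC2); split.
- rewrite size_cat (leq_trans (leq_add s1 s2)) // -cardv [_.+1 ^ k.+1]expnS mulSn addnC expnS.
  by rewrite leq_add ?leq_mul ?leq_expn // -cardN; lia.
- by move=> C; rewrite mem_cat => /orP[/M1|/M2].
move=> T f Y D YD; case: (boolP [exists y in Y, f y == v]) => [/exists_inP[y0 y0Y /eqP fy0]|nv].
  have [C C2 hC] := c2 T f Y D YD; exists C; first by rewrite mem_cat C2 orbT.
  rewrite mulSn addnC; apply: leq_trans (leq_add hC (YD y0 y0Y)).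
  apply: leq_trans (leq_card_setU _ _); apply/subset_leq_card/subsetP => y.
  rewrite !inE fy0; case: (y \in Y) => //=; case: (_ \in C) => //=.
  by case: (_ \in A) => //=; case: (e _ _).
have [C C1 hC] := c1 T f Y D YD; exists C; first by rewrite mem_cat C1.
apply: leq_trans hC; apply/subset_leq_card/subsetP => y; rewrite !inE.
move=> /and3P[yY -> ->]; rewrite yY !andbT /=.
by apply: contraNneq nv => fyv; apply/exists_inP; exists y => //; apply/eqP.
Qed.

(** Union bound over the containers: for a random map [f], the average of
    [2 ^ #|f^-1(C)|] is [(1 + #|C| / #|V|) ^ N]. *)
Lemma exists_spread_map (V : finType) (CC : seq {set V}) (M N z : nat) :
    {in CC, forall C : {set V}, #|C| <= M} ->
    0 < #|V| -> size CC * (#|V| + M) ^ N <= 2 ^ z * #|V| ^ N ->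
  exists f : 'I_N -> V, {in CC, forall C : {set V}, #|[set i | f i \in C]| <= z}.
Proof.
move=> CM V0 num.
case: (pickP (fun f : {ffun 'I_N -> V} => all (fun C : {set V} => #|[set i | f i \in C]| <= z) CC)).
  by move=> f /allP hf; exists f.
move=> none; exfalso.
have one (C : {set V}) : \sum_(f : {ffun 'I_N -> V}) 2 ^ #|[set i | f i \in C]| = (#|V| + #|C|) ^ N.
  have := sum_exp_card (fun (_ : 'I_N) v => v \in C) (2 : nat).
  have expE m n : (m ^+ n)%R = m ^ n :> nat by elim: n => // n IH; rewrite exprS IH expnS.
  rewrite (eq_bigr (fun f : {ffun 'I_N -> V} => (2%N ^+ #|[set i | f i \in C]|)%R)) //.
  move=> ->; rewrite (eq_bigr (fun=> #|V| + #|C|)); last first.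
    move=> i _; rewrite -[#|V|]sum1_card -[#|C|]sum1_card [X in _ + X]big_mkcond -big_split /=.
    by apply: eq_bigr => v _; case: (v \in C).
  by rewrite prodr_const card_ord expE.
have : \sum_(f : {ffun 'I_N -> V}) 2 ^ z < \sum_(f : {ffun 'I_N -> V}) \sum_(C <- CC) 2 ^ #|[set i | f i \in C]|.
  have big (f : {ffun 'I_N -> V}) : 2 ^ z < \sum_(C <- CC) 2 ^ #|[set i | f i \in C]|.
    have /allPn[C CCC] := negbT (none f); rewrite -ltnNge => h.
    rewrite (big_rem C) //=; apply: leq_trans (leq_addr _ _).
    by rewrite ltn_exp2l.
  have [v _] := card_gt0P V0.
  rewrite (bigD1 [ffun=> v]) //= [X in _ < X](bigD1 [ffun=> v]) //= -addSn leq_add //.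
  by apply: leq_sum => f _; rewrite ltnW.
rewrite sum_nat_const card_ffun card_ord exchange_big /= ltnNge mulnC => /negP[].
apply: leq_trans num; rewrite -[size CC]sum1_size big_distrl /= big_seq [X in _ <= X]big_seq.
by apply: leq_sum => C CCC; rewrite one mul1n leq_expn // leq_add2l CM.
Qed.

(** * A graph without K_4 whose sparse sets are small *)

Section Pullback.
Variables (T : finType) (G : sgraph) (f : T -> G).

(** Choosing random vertices with repetition: the points of a fibre of [f] are not
    adjacent, so a complete graph in the pull-back is mapped injectively. *)
Definition pullback_adj : rel T := fun x y => adj (f x) (f y).

Lemma pullback_sym : symmetric pullback_adj.
Proof. by move=> x y; apply: adj_sym. Qed.

Lemma pullback_irrefl : irreflexive pullback_adj.
Proof. by move=> x; apply: adj_irrefl. Qed.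

Definition pullback := SGraph pullback_sym pullback_irrefl.

Lemma pullback_complete_free k : Defs.free (complete k) G -> Defs.free (complete k) pullback.
Proof.
move=> Gfree [g g_inj g_adj]; apply: Gfree; exists (f \o g) => [x y fgxy|x y]; last exact: g_adj.
apply: contraTeq (isT) => xy; have : adj (f (g x)) (f (g y)) by apply: g_adj.
by rewrite /= in fgxy; rewrite fgxy adj_irrefl.
Qed.

End Pullback.

Lemma expn_succ_ge m n : (m + n) * m ^ n <= m * m.+1 ^ n.
Proof.
elim: n => [|n IHn]; first by rewrite addn0.
have : m.+1 * ((m + n) * m ^ n) <= m.+1 * (m * m.+1 ^ n) by rewrite leq_mul2l IHn orbT.
rewrite !expnS; set a := m ^ n; set b := m.+1 ^ n; nia.
Qed.

Lemma double_expn_pred_le m : 0 < m -> 2 * m.-1 ^ m <= m ^ m.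
Proof.
case: m => // -[|m] //= _; have := expn_succ_ge m.+1 m.+2.
rewrite [m.+1 ^ m.+2]expnS; set a := m.+1 ^ _; set b := m.+2 ^ _; nia.
Qed.

Lemma expn_succ_double_le b : (2 * b).+1 ^ (2 * b) <= 4 * (2 * b) ^ (2 * b).
Proof.
case: b => // b; set m := b.+1; have m0 : (0 < (2 * m)%:R :> rat)%R by rewrite ltr0n.
rewrite -(ler_nat rat) natrM !natrX -ler_pdivrMr ?exprn_gt0 // -expr_div_n.
rewrite -natr1 mulrDl divff ?gt_eqF // exprM.
rewrite [X in (X <= _)%R](_ : _ = ((1 + 1 / (2 * m)%:R) ^+ m * (1 + 1 / (2 * m)%:R) ^+ m)%R); last first.
  by rewrite -exprD -exprM mul2n addnn.
have := @exp1D_le rat m (1 / (2 * m)%:R) (ltW (divr_gt0 ltr01 m0)).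
rewrite (_ : m%:R * (1 / (2 * m)%:R) = 1 / 2)%R; last first.
  by rewrite natrM; field; rewrite pnatr_eq0.
move=> /(_ (lexx _)); set y := (_ ^+ m)%R => h.
have y0 : (0 <= y)%R by rewrite exprn_ge0 // addr_ge0 // ltW // divr_gt0.
nra.
Qed.

Lemma linear_le_exp2 n : 4 * (n + 9) + 1 <= 2 ^ (n + 6).
Proof. by elim: n => // n IHn; rewrite [n.+1 + 6]addSn expnS; lia. Qed.

(** The graph behind the upper bound. The secants of the unital of order [q] with
    a good colouring form a [K_4]-free graph on about [q ^ 4] vertices, where
    every set [A] of more than [8 * q ^ 2] vertices has a vertex of degree at
    least [#|A| / (64 * q)] in it. The [k] shrinking steps of the container
    argument, by [1 - 1 / (64 * q)], bring [q ^ 4] below [8 * q ^ 2], and a random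
    map from [N] points puts few points in each container. *)
Theorem sparse_sets_small (c N : nat) (q := 2 ^ c) (k := 128 * c * q) : 9 <= c ->
  exists G : sgraph, [/\ #|G| = N, Defs.free (complete 4) G &
    forall (Y : {set G}) (D : nat), {in Y, forall y, #|[set y' in Y | adj y y']| <= D} ->
      #|Y| <= (4 * c + 1) * k + 2 * (N %/ 2 ^ (2 * c - 4)).+1 + k * D].
Proof.
move=> c9; have c0 : 0 < c by apply: leq_trans c9.
have [P [L [inc [spec cardP L_ge L_le line_ge]]]] := hermitian_unital c0.
rewrite -/q in cardP L_ge L_le line_ge.
(* With [t = q / 8], a good colouring has both parameters [d] and [e] equal to [t]. *)
pose t := 2 ^ (c - 3); have t_ge : 4 * c + 1 <= t.
  by have := linear_le_exp2 (c - 9); rewrite subnK // /t; congr (_ <= 2 ^ _); lia.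
have qt : q = 8 * t by rewrite /q /t -(expnD 2 3); congr (2 ^ _); lia.
have t0 : 0 < t by lia.
have q0 : 0 < q by lia.
have [|||| chi good] := @exists_good_colouring P L inc (8 * q ^ 2) q t t.
- by rewrite muln_gt0 expn_gt0 q0.
- by apply: leq_trans cardP _; rewrite mulnCA mulnA -qt -expnS.
- by [].
- have q4 : 2 * q ^ 4 <= 2 ^ t.
    rewrite /q -expnM -expnS leq_exp2l //; lia.
  apply: leq_trans (leq_mul (leq_mul (leq_mul (leqnn 2) L_le) (leqnn _)) (leqnn _)) _.
  apply: (@leq_trans (2 ^ t * 2 ^ (t + t) * 3 ^ q)); first by rewrite leq_mul2r leq_mul2r q4 !orbT.
  rewrite expnD qt !expnM -!expnMn leq_expn //; lia.
set G := secant_graph inc chi.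
have dense (A : {set G}) : 8 * q ^ 2 < #|A| ->
    exists2 v, v \in A & #|A| <= 64 * q * #|[set u in A | adj v u]|.
  move=> MA; have A0 : 0 < #|A| by apply: leq_ltn_trans MA.
  have [b|v vA deg] := @exists_large_degree P L inc chi spec A t A0.
    by apply: good; apply: ltnW.
  exists v => //; have t2 : 0 < t ^ 2 by rewrite expn_gt0 t0.
  rewrite -(leq_pmul2l t2); apply: (leq_trans deg).
  rewrite mulnA leq_mul2r; apply/orP; right; apply: (leq_trans cardP).
  by rewrite qt; lia.
have L_gt : q ^ 4 <= 2 * #|L|.
  have : 2 * q ^ 3 <= q ^ 4 by rewrite [q ^ 4]expnS leq_mul2r qt; lia.
  by lia.
have [||CC [sizeCC CCM cover]] := @container_family G (@adj G) (8 * q ^ 2) (64 * q) _ dense k setT.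
- by rewrite muln_gt0 q0.
- rewrite cardsT.
  have -> : k = 64 * q * (2 * c) by rewrite /k; lia.
  apply: leq_trans (leq_mul L_le (leqnn _)) _; rewrite (expnM (64 * q) (64 * q)) (expnM (64 * q).-1 (64 * q)).
  have := @leq_expn (2 * c) _ _ (@double_expn_pred_le (64 * q) _).
  rewrite muln_gt0 q0 => /(_ isT); rewrite expnMn.
  have -> : q ^ 4 = q ^ 2 * 2 ^ (2 * c) by rewrite /q -!expnM -expnD; congr (2 ^ _); lia.
  move=> h; rewrite -mulnA; apply: leq_trans (leq_mul (leqnn _) h) _.
  by rewrite leq_mul2r leq_pmull // orbT.
have [||f hf] := @exists_spread_map G CC (8 * q ^ 2) N ((4 * c + 1) * k + 2 * (N %/ 2 ^ (2 * c - 4)).+1) CCM.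
- by rewrite -(ltn_pmul2l (isT : 0 < 2)) muln0 (leq_trans _ L_gt) // expn_gt0 q0.
- set u := (_ %/ _).+1.
  pose a := 2 ^ (2 * c - 4); have a0 : 0 < a by rewrite expn_gt0.
  have qa : q ^ 2 = 16 * a.
    by rewrite /q /a -(expnD 2 4) -expnM; congr (2 ^ _); lia.
  have Nau : N <= a * u by rewrite mulnC /u ltnW // ltn_ceil.
  rewrite expnD -mulnA; apply: leq_mul.
    apply: (leq_trans sizeCC); rewrite cardsT expnM leq_expn //.
    apply: (@leq_trans (2 * q ^ 4)).
      have q4 : 0 < q ^ 4 by rewrite expn_gt0 q0.
      by apply: (leq_trans (_ : _ <= (q ^ 4).+1)); rewrite ?ltnS //; lia.
    by rewrite /q -expnM -expnS leq_exp2l //; lia.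
  (* [(1 + 1 / a) ^ N <= 4 ^ (N / a)], from [(1 + 1 / a) ^ a <= 4]. *)
have step : (a.+1) ^ N <= 4 ^ u * a ^ N.
    have aD : 0 < a ^ (a * u - N) by rewrite expn_gt0 a0.
    rewrite -(leq_pmul2r aD) -mulnA -expnD subnKC //.
    apply: (@leq_trans (a.+1 ^ (a * u))).
      by rewrite -[in X in _ <= X](subnKC Nau) expnD leq_mul2l leq_expn ?orbT.
    rewrite !(expnM _ a) -expnMn leq_expn //.
    have -> : a = 2 * 2 ^ (2 * c - 5) by rewrite -expnS /a; congr (2 ^ _); lia.
    exact: expn_succ_double_le.
  have aN : 0 < a ^ N by rewrite expn_gt0 a0.
  rewrite -(leq_pmul2l aN) -expnMn expnM.
  apply: (@leq_trans (a.+1 ^ N * #|L| ^ N)).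
    rewrite -expnMn leq_expn // mulnDr mulSn addnC leq_add2r.
    by move: L_gt; rewrite (expnM q 2 2) qa; nia.
  by rewrite mulnA leq_mul2r mulnC step orbT.
exists (pullback f); split.
- exact: card_ord.
- exact/pullback_complete_free/secant_graph_K4_free.
move=> Y D YD.
have [C CCC hC] := cover _ f Y D YD.
rewrite -(cardsID [set i | f i \in C] Y) leq_add //.
  by apply: leq_trans (hf C CCC); apply/subset_leq_card/subsetIr.
apply: leq_trans hC; apply/subset_leq_card/subsetP => y.
by rewrite !inE andbT => /andP[-> ->].
Qed.

(** * Sparse subsets of F-free sets *)

From mathcomp Require Import all_classical all_reals all_analysis.

Lemma card_edges_le (G : sgraph) : #|edges G| <= 'C(#|G|, 2).
Proof.
rewrite -card_draws; apply/subset_leq_card/fintype.subsetP => e.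
rewrite !inE => /existsP[x /existsP[y /andP[xy /eqP ->]]].
rewrite cards2; move: xy; case: (x =P y) => [->|//].
by rewrite adj_irrefl.
Qed.

Lemma card_edges_le_ex (F G : sgraph) : Defs.free F G -> #|edges G| <= ex F #|G|.
Proof.
move=> FG; have lt : #|edges G| < 'C(#|G|, 2).+1 by rewrite ltnS card_edges_le.
rewrite /ex; apply: (bigop.leq_bigmax_cond (Ordinal lt)).
by apply/asboolP; exists G.
Qed.

Lemma sum_degree_le (G : sgraph) :
  \sum_(x : G) #|[set y | adj x y]| <= 2 * #|edges G|.
Proof.
have -> : \sum_(x : G) #|[set y | adj x y]| = #|[set u : G * G | adj u.1 u.2]|.
  rewrite -[RHS]sum1dep_card (partition_big (fun u => u.1) predT) //=.
  apply: eq_bigr => x _; rewrite sum1_card.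
  rewrite -[LHS](card_imset _ (fun u v => (fun e : (x, u) = (x, v) => congr1 snd e))).
  apply: eq_card => -[x' y]; rewrite unfold_in /=.
  apply/imsetP/andP => [[y' + [-> ->]]|[xy /eqP e]]; first by rewrite inE eqxx.
  by exists y; rewrite ?inE -e.
rewrite mulnC -sum_nat_const -[leqLHS]sum1dep_card.
rewrite (partition_big (fun u => [set u.1; u.2]) (mem (edges G))) /=; last first.
  move=> [x y] /= xy; rewrite inE; apply/existsP; exists x; apply/existsP; exists y.
  by rewrite xy eqxx.
apply: leq_sum => e; rewrite inE => /existsP[x /existsP[y /andP[xy /eqP ->]]].
rewrite sum1_card; apply: (@leq_trans #|[set (x, y); (y, x)]|); last first.
  by rewrite cards2; case: (_ != _).
apply/subset_leq_card/fintype.subsetP => -[u v]; rewrite unfold_in !inE /= => /andP[uv /eqP euv].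
have := set21 u v; have := set22 u v; rewrite euv !inE.
move=> /orP[] /eqP ev /orP[] /eqP eu; subst; rewrite ?eqxx ?orbT //.
all: by rewrite adj_irrefl in uv.
Qed.

Lemma sum_induced_degree_le (F G : sgraph) (S : {set G}) : Defs.free F (Defs.induced S) ->
  \sum_(x in S) #|[set y in S | adj x y]| <= 2 * ex F #|S|.
Proof.
move=> FS; have := sum_degree_le (Defs.induced S).
have -> : \sum_(x : Defs.induced S) #|[set y | adj x y]| = \sum_(x in S) #|[set y in S | adj x y]|.
  transitivity (\sum_(x : {x | x \in S}) #|[set y in S | adj (val x) y]|).
    apply: eq_bigr => x _; rewrite -(card_imset _ val_inj); apply: eq_card => y.
    apply/imsetP/idP => [[z + ->]|]; first by rewrite !inE (valP z).
    rewrite inE => /andP[yS xy]; by exists (exist _ y yS); rewrite ?inE.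
  by rewrite [RHS]big_sub.
move=> /leq_trans; apply; rewrite leq_mul2l /=.
by have := card_edges_le_ex FS; rewrite [#|Defs.induced S|]card_sig.
Qed.

(** By the handshake lemma, at least half of the vertices of an [F]-free set of
    size [m] have degree at most [4 * ex F m / m] in it, and [sparse_sets_small]
    bounds the number of those. *)
Lemma free_set_bound (F : sgraph) (c n m D : nat) (q := 2 ^ c) (k := 128 * c * q) :
    9 <= c -> 4 * ex F m <= D.+1 * m ->
    (forall G : sgraph, #|G| = n -> Defs.free (complete 4) G ->
       exists2 S : {set G}, #|S| = m & Defs.free F (Defs.induced S)) ->
  m <= 2 * ((4 * c + 1) * k + 2 * (n %/ 2 ^ (2 * c - 4)).+1 + k * D).
Proof.
move=> c9 exD all_graphs.
have [G [cardG K4 small]] := sparse_sets_small n c9.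
have [S cardS FS] := all_graphs G cardG K4.
pose Y := [set y in S | #|[set z in S | adj y z]| <= D].
have YS : Y \subset S by apply/fintype.subsetP => y; rewrite inE => /andP[].
have half : m <= 2 * #|Y|.
  have := sum_induced_degree_le FS; rewrite cardS.
  have : D.+1 * #|S :\: Y| <= \sum_(x in S) #|[set y in S | adj x y]|.
    rewrite mulnC -sum_nat_const [leqRHS](bigID (mem Y)) /= addnC.
    apply: leq_trans (leq_addr _ _).
    rewrite [leqRHS](eq_bigl (mem (S :\: Y))); last by move=> x; rewrite !inE andbC.
    apply: leq_sum => x; rewrite !inE => /andP[+ xS]; rewrite xS /=.
    by rewrite -ltnNge.
  have : #|Y| + #|S :\: Y| = m by rewrite -cardS -(cardsID Y S) (finset.setIidPr YS).
  nia.
apply: (leq_trans half); rewrite leq_mul2l /=; apply: small => y yY.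
move: (yY); rewrite inE => /andP[yS]; apply: leq_trans.
apply/subset_leq_card/fintype.subsetP => z; rewrite !inE => /andP[/andP[-> _] ->] //.
Qed.

(** * Asymptotics *)

Unset Implicit Arguments.
Import numFieldNormedType.Exports.
Local Open Scope classical_set_scope.
Local Open Scope ring_scope.

Lemma floor_power_of_two (R : realType) (Q : R) (k : nat) : 2 ^+ k <= Q ->
  exists c : nat, [/\ (k <= c)%N, 2 ^+ c <= Q & Q <= 2 * 2 ^+ c].
Proof.
move=> Qk; have Q0 : 0 <= Q by apply: le_trans Qk; rewrite exprn_ge0.
have tQk : (2 ^ k <= Num.truncn Q)%N by rewrite truncn_ge_nat // natrX.
have tQ0 : (0 < Num.truncn Q)%N by apply: leq_trans tQk; rewrite expn_gt0.
have /andP[c_le c_gt] := trunc_log_bounds (isT : (1 < 2)%N) tQ0.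
exists (trunc_log 2 (Num.truncn Q)); split.
- exact: trunc_log_max.
- by rewrite -natrX -truncn_ge_nat.
- by rewrite -exprS -natrX ltW // -truncn_lt_nat.
Qed.

(** The choice of the order [q = 2 ^ c]: up to a factor 2, it is
    [Q = tau ^ (1 - alpha) / ln n ^ 2]. As [tau ^ (3 - 2 * alpha) = n * ln n ^ 4],
    this gives [n / Q ^ 2 = tau], which balances the terms of [free_set_bound].
    With [l = ln n] and [h = ln (ln n)], everything is an exponential of a linear
    combination of [l] and [h]. *)
Lemma choose_scale (R : realType) (alpha : R) (n : nat) :
    0 <= alpha -> alpha < 1 / 2 -> 200 <= ln n%:R :> R ->
  let tau := n%:R `^ (1 / (3 - 2 * alpha)) * ln n%:R `^ (4 / (3 - 2 * alpha)) : R in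
  exists c : nat, [/\ (9 <= c)%N, 1 <= tau, c%:R <= 2 * ln n%:R :> R,
    (2 ^+ c) * ln n%:R ^+ 2 <= tau `^ (1 - alpha) &
    n%:R <= 4 * tau * (2 ^+ c) ^+ 2].
Proof.
move=> a0 a1 l200; set l := ln n%:R in l200 *.
have l0 : 0 < l by lra.
have n0 : 0 < n%:R :> R.
  by rewrite ltNge; apply/negP => /ln0 e; move: l0; rewrite /l e ltxx.
have nE : n%:R = expR l by rewrite lnK.
have [h lE] : exists h : R, l = expR h by exists (ln l); rewrite lnK.
have h0 : 0 <= h by rewrite -ler_expR expR0 -lE; lra.
have hl : h <= l / 8 + 8.
  have : ln (l / 8) < l / 8 by apply: ln_sublinear; rewrite divr_gt0.
  rewrite ln_div ?posrE // [in ln l]lE expRK => h1.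
  have : ln 8 < 8 :> R by apply: ln_sublinear.
  lra.
pose b := (3 - 2 * alpha)^-1; have b0 : 0 < b by rewrite invr_gt0; lra.
have bE : b * (3 - 2 * alpha) = 1 by rewrite mulVf //; apply/eqP; lra.
pose t := b * (l + 4 * h).
have t0 : 0 <= t by rewrite mulr_ge0 ?ltW //; lra.
move=> tau; have tauE : tau = expR t.
  rewrite /tau nE lE /powR !gt_eqF ?expR_gt0 // !expRK -expRD; congr expR.
  by rewrite /t /b -lE; ring.
pose x := (1 - alpha) * t - 2 * h.
have xE : x = (1 - alpha) * b * l + (4 * (1 - alpha) * b - 2) * h by rewrite /x /t; ring.
have b1 : (1 - alpha) * b <= 1 / 3 by nra.
have b2 : 1 / 4 <= (1 - alpha) * b by nra.
have x_le : x <= l / 3 by rewrite xE; nra.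
have x_ge : l / 4 - h <= x by rewrite xE; nra.
have x17 : 17 <= x by lra.
pose Q := expR x.
have ln2_le : ln 2 <= 1 :> R.
  by have := @le_ln1Dx R 1; rewrite (_ : 1 + 1 = 2) //; apply; lra.
have ln2_ge : 1 / 2 <= ln 2 :> R.
  have := @le_ln1Dx R (- 2^-1); rewrite (_ : 1 - 2^-1 = 2^-1); last by field.
  rewrite lnV ?posrE // => /(_ ltac:(lra)); lra.
have Q9 : 2 ^+ 9 <= Q.
  rewrite -[2]lnK ?posrE // -expRM_natl ler_expR; lra.
have [c [c9 qQ Qq]] := floor_power_of_two _ _ _ Q9.
exists c; split.
- by [].
- by rewrite tauE -expR0 ler_expR.
- have : c%:R * ln 2 <= x.
    by rewrite -ler_expR mulrC expRM_natr lnK ?posrE.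
  by nra.
- rewrite tauE /powR gt_eqF ?expR_gt0 // expRK.
  apply: (@le_trans _ _ (Q * l ^+ 2)); first by rewrite ler_wpM2r ?exprn_ge0 // ltW.
  rewrite lE -expRM_natl /Q -expRD ler_expR /x; lra.
- apply: (@le_trans _ _ (tau * Q ^+ 2)).
    rewrite nE tauE /Q -expRM_natl -expRD ler_expR /x.
    have : t * (3 - 2 * alpha) = l + 4 * h by rewrite /t mulrAC bE mul1r.
    lra.
  have t1 : 0 <= tau by rewrite tauE expR_ge0.
  have q0 : 0 <= 2 ^+ c :> R by rewrite exprn_ge0.
  rewrite [leRHS](_ : _ = tau * (4 * (2 ^+ c) ^+ 2)); last by ring.
  by apply: ler_wpM2l => //; nra.
Qed.

(** An inequality [x <= K * tau ^ (1 - alpha) * x ^ alpha] is homogeneous in [x]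
    and [tau], so it bounds [x / tau]. *)
Lemma powR_selfbound (R : realType) (alpha K x tau : R) :
    alpha < 1 -> 1 <= K -> 0 < tau -> 0 < x -> x <= K * (tau `^ (1 - alpha) * x `^ alpha) ->
  x <= K `^ ((1 - alpha)^-1) * tau.
Proof.
move=> a1 K1 tau0 x0 h; have b0 : 0 < 1 - alpha by lra.
have K0 : 0 < K by lra.
have h1 : x `^ (1 - alpha) <= K * tau `^ (1 - alpha).
  have xa : 0 < x `^ alpha by apply: powR_gt0.
  rewrite -(ler_pM2r xa) -powRD; last by rewrite (gt_eqF x0) implybT.
  by rewrite subrK powRr1 ?(ltW x0) // -mulrA.
have ib0 : 0 <= (1 - alpha)^-1 by rewrite invr_ge0 ltW.
have lhs0 : x `^ (1 - alpha) \in Num.nneg by rewrite nnegrE powR_ge0.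
have rhs0 : K * tau `^ (1 - alpha) \in Num.nneg by rewrite nnegrE mulr_ge0 ?powR_ge0 ?ltW.
have := ge0_ler_powR ib0 lhs0 rhs0 h1.
rewrite powRM ?powR_ge0 ?(ltW K0) // -!powRrM mulfV ?gt_eqF //.
by rewrite !powRr1 ?(ltW x0) ?(ltW tau0).
Qed.

(** The bound of [free_set_bound] in terms of [tau], for [s = tau ^ (1 - alpha)],
    [z = m ^ alpha] and [l = ln n]: each of its terms is of order at most
    [s * z]. *)
Lemma collect_terms (R : realFieldType) (C tau s z q l c p m D : R) :
    0 < C -> 200 <= l -> 0 < q -> 1 <= c -> c <= 2 * l -> q * l ^+ 2 <= s ->
    1 <= tau -> s <= tau -> tau <= s * z -> 0 <= z ->
    p <= 64 * tau + 1 -> 0 <= D -> D <= 4 * C * z ->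
    m <= 2 * ((4 * c + 1) * (128 * c * q) + 2 * p + 128 * c * q * D) ->
  m <= (6000 + 2048 * C) * (s * z).
Proof.
move=> C0 l200 q0 c1 cl qs tau1 s_tau tau_z z0 p_le D0 D_le m_le.
have c0 : 0 <= c by apply: le_trans c1.
have l1 : 1 <= l by clear - l200; lra.
have l0 : 0 <= l by apply: le_trans l1.
have q_ge0 : 0 <= q := ltW q0.
have C_ge0 : 0 <= C := ltW C0.
have cc : c * c <= 4 * l ^+ 2 by clear - c0 cl; nra.
have ql : q * l <= s.
  apply: le_trans qs; rewrite expr2 mulrA; apply: ler_peMr l1.
  exact: mulr_ge0.
have qc : q * c <= q * (c * c) by apply: ler_wpM2l; [exact: ltW|exact: ler_peMr].
have qcc : q * (c * c) <= q * (4 * l ^+ 2) by apply: ler_wpM2l.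
have cqD : c * q * D <= 2 * l * q * (4 * C * z).
  apply: ler_pM D_le => //; first exact: mulr_ge0.
  by apply: ler_wpM2r.
have qlCz : q * l * (C * z) <= s * (C * z).
  by apply: ler_wpM2r ql; apply: mulr_ge0.
have lin : (4 * c + 1) * (128 * c * q) <= 2560 * s by clear - qc qcc qs; lra.
have kD : 128 * c * q * D <= 1024 * C * (s * z) by clear - cqD qlCz; lra.
clear - lin kD m_le p_le tau1 s_tau tau_z; lra.
Qed.

Lemma sqr_pow2 (R : realFieldType) (c : nat) : (2 <= c)%N ->
  (2 ^+ c) ^+ 2 = 16 * (2 ^ (2 * c - 4))%:R :> R.
Proof.
move=> c2; have cE : (c * 2 = 4 + (2 * c - 4))%N by lia.
by rewrite natrX -exprM cE exprD; congr (_ * _); rewrite -natrX.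
Qed.

Theorem theorem1p2 (R : realType) (alpha : R) (F : sgraph) :
  0 <= alpha -> alpha < 1 / 2 ->
  ((fun m : nat => (ex F m)%:R : R) =O_\oo
     (fun m : nat => m%:R `^ (1 + alpha) : R)) ->
  ((fun n : nat => (induced_free_number F (complete 4) n)%:R : R) =O_\oo
     (fun n : nat => n%:R `^ (1 / (3 - 2 * alpha)) *
                     ln n%:R `^ (4 / (3 - 2 * alpha)) : R)).
Proof.
move=> a0 a1 /eqO_exP [C C0 [m0 _ exC]].
have alpha1 : alpha < 1 by lra.
have beta1 : 1 - alpha <= 1 by lra.
have K1 : 1 <= 6000 + 2048 * C by lra.
pose K := 6000 + 2048 * C; pose K' := K `^ ((1 - alpha)^-1).
apply/eqO_exP; exists (m0%:R + 1 + K').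
  by rewrite ltr_pwDl ?powR_ge0 // ltr_wpDl.
near=> n.
have l200 : 200 <= ln n%:R :> R.
  have n_ge : expR 200 <= n%:R :> R by near: n; exact: nbhs_infty_ger.
  by rewrite -[leLHS]expRK ler_ln ?posrE ?expR_gt0 // (lt_le_trans _ n_ge) ?expR_gt0.
have /= [c [c9 tau1 cl qtau ntau]] := choose_scale _ _ _ a0 a1 l200.
set tau := (X in _ <= _ * `|X|).
rewrite -/tau in tau1 qtau ntau.
have tau0 : 0 < tau := lt_le_trans ltr01 tau1.
rewrite ger0_norm // ger0_norm ?(ltW tau0) //.
have K'0 : 0 <= K' by apply: powR_ge0.
have B1 : 1 <= m0%:R + 1 + K' by rewrite -addrA addrCA lerDl addr_ge0.
have tauB : tau <= (m0%:R + 1 + K') * tau by apply: ler_peMl B1; apply: ltW.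
suff bound m : (forall G : sgraph, #|G| = n -> Defs.free (complete 4) G ->
     exists2 S : {set G}, #|S| = m & Defs.free F (Defs.induced S)) ->
    m%:R <= (m0%:R + 1 + K') * tau.
  rewrite /induced_free_number; elim/bigop.big_ind: _ => [|x y hx hy|i /asboolP].
  - exact: le_trans (ltW tau0) tauB.
  - by rewrite /maxn; case: ifP.
  - exact: bound.
move=> all_graphs.
have [mm0|m0m] := leqP m m0.+1.
  apply: (@le_trans _ _ (m0.+1)%:R); first by rewrite ler_nat.
  apply: (@le_trans _ _ (m0%:R + 1 + K')); first by rewrite -natr1 lerDl.
  by apply: ler_peMr tau1; apply: le_trans B1.
have [mtau|taum] := leP m%:R tau; first exact: le_trans tauB.
have m_gt0 : 0 < m%:R :> R := lt_trans tau0 taum.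
set z : R := m%:R `^ alpha.
have z0 : 0 <= z by apply: powR_ge0.
have exm : (ex F m)%:R <= C * (m%:R * z).
  have /= := exC m (ltnW (ltnW m0m)).
  rewrite !ger0_norm ?powR_ge0 // powRD; last by rewrite (gt_eqF m_gt0) implybT.
  by rewrite powRr1.
pose D := Num.truncn (4 * C * z).
have Cz0 : 0 <= 4 * C * z by rewrite !mulr_ge0 // ltW.
have /andP[D_le D_gt] := truncn_itv Cz0.
have exD : (4 * ex F m <= D.+1 * m)%N.
  rewrite -(ler_nat R) !natrM.
  apply: (@le_trans _ _ (4 * C * z * m%:R)); last by rewrite ler_wpM2r // ltW.
  by rewrite [leRHS](_ : _ = 4 * (C * (m%:R * z))); [rewrite ler_wpM2l|ring].
have := free_set_bound c9 exD all_graphs.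
rewrite -(ler_nat R) !(natrM, natrD) natrX.
set q : R := 2 ^+ c in qtau ntau *; set l := ln n%:R in l200 cl qtau *.
have q0 : 0 < q by rewrite exprn_gt0.
set p := (n %/ _)%N.+1%:R.
have p_le : p <= 64 * tau + 1.
  rewrite /p -natr1 lerD2r; set a := (2 ^ (2 * c - 4))%N.
  have a0' : 0 < a%:R :> R by rewrite ltr0n expn_gt0.
  have qa : q ^+ 2 = 16 * a%:R by apply: sqr_pow2; apply: leq_trans c9.
  rewrite -(ler_pM2r a0'); apply: (@le_trans _ _ n%:R).
    by rewrite -natrM ler_nat leq_trunc_div.
  have -> : 64 * tau * a%:R = 4 * tau * q ^+ 2 by rewrite qa; ring.
  exact: ntau.
move=> m_le; set s := tau `^ (1 - alpha) in qtau.
have s_tau : s <= tau by exact: ler1_powR.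
have s_z : tau <= s * z.
  rewrite -[leLHS]powRr1 ?(ltW tau0) // -[X in _ `^ X](subrK alpha).
  rewrite powRD; last by rewrite (gt_eqF tau0) implybT.
  apply: ler_wpM2l; first exact: powR_ge0.
  by apply: ge0_ler_powR; rewrite // ?nnegrE ltW.
have c1 : 1 <= c%:R :> R by rewrite ler1n; apply: leq_trans c9.
have h := collect_terms _ _ _ _ _ _ _ _ _ _ _ C0 l200 q0 c1 cl qtau tau1 s_tau s_z z0 p_le
  (ler0n _ _) D_le m_le.
have := powR_selfbound _ _ _ _ _ alpha1 K1 tau0 m_gt0 h; rewrite -/K' => hK.
by apply: (le_trans hK); rewrite ler_wpM2r ?(ltW tau0) // lerDr addr_ge0.
Unshelve. all: by end_near.
Qed.
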